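(* Let $K(m)$ be the cell-centered finite volume matrix with a single highly-diffusive island defined in the context, let $$A(m)=\big(\operatorname{diag}K(m)\big)^{-1/2}K(m)\big(\operatorname{diag}K(m)\big)^{-1/2}$$ be its diagonally scaled version, and let $\lambda_{\min}(A(m))=\lambda_1(A(m))\le\lambda_2(A(m))\le\dots\le\lambda_n(A(m))$ be its eigenvalues. Then, asymptotically as $m\to\infty$, $$C_1\,m^{-1}\le\lambda_{\min}(A(m))\le C_2\,m^{-1/2},$$ with $C_1=\lambda_{\min}(A(1))$ and a constant $C_2$ independent of $m$, and $$\lambda_k(A(m))\ge C\quad\text{for all }k\ge 2,$$ for some constant $C>0$ independent of $m$. Thus $A(m)$ has a single eigenvalue approaching zero, while the remaining eigenvalues are bounded away from $0$.
   Context: Grid and coefficient. The unit square $\Omega$ is divided into a fixed uniform $N\times N$ grid of square cells, one unknown per cell, $n=N^2$. Two cells are adjacent if they share an edge. The set of cells is partitioned into a single edge-connected island $\Omega_1$ (highly-diffusive) and its complement $\Omega_2$. The coefficient is $\alpha_p=m\ge1$ for cells $p$ in $\Omega_1$ and $\alpha_p=1$ for cells $p$ in $\Omega_2$. Matrix. $K(m)$ is the symmetric positive definite matrix of the 5-point conservative finite volume discretization of $-\nabla\cdot(\alpha\nabla u)=f$ in $\Omega$, $u=0$ on $\partial\Omega$, with harmonic averaging of the coefficient. For adjacent cells $p\ne q$, $[K(m)]_{pq}=-\frac{2\alpha_p\alpha_q}{\alpha_p+\alpha_q}$; for non-adjacent $p\neq q$, $[K(m)]_{pq}=0$. With $\overline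 h_m=\frac{2m}{m+1}$, every cell $p$ is of one of the following types, with the indicated diagonal entry $[K(m)]_{pp}$: - $p$ in the island with all four neighbours in the island: $4m$; - $p$ in the island, adjacent to exactly one cell of $\Omega_2$ (non-corner interface cell): $3m+\overline h_m$; - $p$ in the island, adjacent to exactly two cells of $\Omega_2$ (corner interface cell): $2m+2\overline h_m$; - $p$ in $\Omega_2$ adjacent to the island (to exactly one island cell, and not touching $\partial\Omega$): $3+\overline h_m$; - $p$ in $\Omega_2$ not adjacent to the island: $4$ if $p$ has no edge on $\partial\Omega$, $5$ if $p$ has one edge on $\partial\Omega$, $6$ if $p$ is a corner cell of $\Omega$. $\operatorname{diag}K(m)$ is the diagonal matrix with the diagonal entries of $K(m)$. The grid and the island are fixed as $m\to\infty$. *)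

(* Defs.v *)
From HB Require Import structures.
From mathcomp Require Import all_boot all_order all_algebra.
From mathcomp Require Import polyrcf.
From mathcomp Require Import all_classical all_reals all_analysis.
From mathcomp Require Import ring lra zify.

Set Implicit Arguments.
Unset Strict Implicit.
Unset Printing Implicit Defensive.

Import Order.TTheory GRing.Theory Num.Theory.
Import numFieldNormedType.Exports.

Local Open Scope ring_scope.

Section Grid.
Variable N : nat.

(* Cell (i, j) is the square [i/N, (i+1)/N] x [j/N, (j+1)/N]. *)
Definition cell : finType := ('I_N * 'I_N)%type.

Definition consecutive (i j : 'I_N) : bool := (i.+1 == j) || (j.+1 == i).

Definition adjacent (p q : cell) : bool :=
  ((p.1 == q.1) && consecutive p.2 q.2)
  || ((p.2 == q.2) && consecutive p.1 q.1).

(* Number of edges of the cell p that lie on the boundary of the unit square. *)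
Definition boundary_edges (p : cell) : nat :=
  ((p.1 == 0 :> nat) + (p.1.+1 == N) + (p.2 == 0 :> nat) + (p.2.+1 == N))%N.

Definition nb_neighbours (S : {set cell}) (p : cell) : nat :=
  #|[set q in S | adjacent p q]|.

Definition edge_connected (S : {set cell}) : Prop :=
  {in S &, forall p q,
     connect [rel x y | [&& x \in S, y \in S & adjacent x y]] p q}.

(* Every cell is of one of the types for which [fv_entry_diag] below lists
   the diagonal entry of the matrix: island cells have four neighbours, at most
   two of them outside the island, and a cell outside the island that touches
   it does so along a single edge and has no edge on the boundary. *)
Definition admissible_types (S : {set cell}) : Prop :=
  forall p : cell,
    if p \in S then boundary_edges p = 0%N /\ (nb_neighbours (~: S) p <= 2)%N
    else nb_neighbours S p = 0%N \/
         (nb_neighbours S p = 1%N /\ boundary_edges p = 0%N).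

Definition is_island (S : {set cell}) : Prop :=
  [/\ S != finset.set0, edge_connected S & admissible_types S].

End Grid.

Section Discretization.
Variables (R : realType) (N : nat) (Omega1 : {set cell N}).

Definition coeff (m : R) (p : cell N) : R := if p \in Omega1 then m else 1.

Definition harmonic_mean (a b : R) : R := 2 * a * b / (a + b).

(* The diagonal sums the transmissibilities of the four edges of p; an edge on
   the Dirichlet boundary is at distance half a cell from the centre of p, which
   gives 2 * coeff m p. *)
Definition fv_entry (m : R) (p q : cell N) : R :=
  if p == q then
    \sum_(r | adjacent p r) harmonic_mean (coeff m p) (coeff m r)
      + (2 * coeff m p) *+ boundary_edges p
  else if adjacent p q then - harmonic_mean (coeff m p) (coeff m q)
  else 0.

Definition fv_matrix (m : R) : 'M[R]_#|cell N| :=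
  \matrix_(i, j) fv_entry m (enum_val i) (enum_val j).

End Discretization.

Lemma card_next (N : nat) (i : 'I_N) :
  (#|[set j : 'I_N | i.+1 == j]| + (i.+1 == N) = 1)%N.
Proof.
case: eqP => [iN|/eqP iN].
  rewrite (_ : [set j : 'I_N | _] = finset.set0) ?cards0 //.
  by apply/setP => j; rewrite !inE iN gtn_eqF // ltn_ord.
have ltiN : (i.+1 < N)%N by rewrite ltn_neqAle iN ltn_ord.
rewrite (_ : [set j : 'I_N | _] = [set Ordinal ltiN]%SET) ?cards1 //.
by apply/setP => j; rewrite !inE -val_eqE eq_sym.
Qed.

Lemma card_prev (N : nat) (i : 'I_N) :
  (#|[set j : 'I_N | j.+1 == i]| + (i == 0 :> nat) = 1)%N.
Proof.
case: eqP => [i0|/eqP i0].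
  rewrite (_ : [set j : 'I_N | _] = finset.set0) ?cards0 //.
  by apply/setP => j; rewrite !inE /= [nat_of_ord i]i0.
have ltiN : (i.-1 < N)%N by rewrite (leq_ltn_trans (leq_pred i)).
rewrite (_ : [set j : 'I_N | _] = [set Ordinal ltiN]%SET) ?cards1 //.
apply/setP => j; rewrite !inE -val_eqE /=.
by rewrite -{1}(prednK (n := i)) ?lt0n // eqSS.
Qed.

Lemma card_consecutive (N : nat) (i : 'I_N) :
  (#|[set j | consecutive i j]| + (i == 0 :> nat) + (i.+1 == N) = 2)%N.
Proof.
have -> : [set j | consecutive i j] =
    ([set j : 'I_N | i.+1 == j] :|: [set j : 'I_N | j.+1 == i])%SET.
  by apply/setP => j; rewrite !inE.
rewrite cardsU (_ : (_ :&: _)%SET = finset.set0) ?cards0 ?subn0.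
  by have := card_next i; have := card_prev i; lia.
by apply/setP => j; rewrite !inE; apply/negP; lia.
Qed.

Lemma card_adjacent (N : nat) (p : cell N) :
  (#|[set q | adjacent p q]| + boundary_edges p = 4)%N.
Proof.
have -> : [set q | adjacent p q] =
    (finset.setX [set p.1] [set j | consecutive p.2 j]
     :|: finset.setX [set j | consecutive p.1 j] [set p.2])%SET.
  apply/setP => q; rewrite !inE /adjacent (eq_sym q.1) (eq_sym q.2).
  by rewrite [X in _ || X]andbC.
rewrite cardsU (_ : (_ :&: _)%SET = finset.set0).
  rewrite cards0 subn0 !cardsX !cards1 mul1n muln1 /boundary_edges.
  by have := card_consecutive p.1; have := card_consecutive p.2; lia.
apply/setP => q; rewrite !inE /consecutive; apply/negP.
case/andP => /andP[/eqP-> _] /andP[+ _]; lia.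
Qed.

Lemma nb_neighboursD (N : nat) (S : {set cell N}) (p : cell N) :
  (nb_neighbours S p + nb_neighbours (~: S) p + boundary_edges p = 4)%N.
Proof.
rewrite -(card_adjacent p) -(cardsID S [set q | adjacent p q]); congr (_ + _ + _)%N.
  by apply: eq_card => q; rewrite !inE andbC.
by apply: eq_card => q; rewrite !inE.
Qed.

Lemma fv_entry_diag (R : realType) (N : nat) (S : {set cell N}) (m : R)
    (p : cell N) (h := 2 * m / (m + 1)) : 1 <= m -> admissible_types S ->
  fv_entry S m p p =
    if p \in S then
      match nb_neighbours (~: S) p with
      | 0 => 4 * m
      | 1 => 3 * m + h
      | _ => 2 * m + 2 * h
      end
    else if nb_neighbours S p == 1%N then 3 + h
    else 4 + (boundary_edges p)%:R.
Proof.
move=> m1 /(_ p) adm; rewrite /fv_entry eqxx.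
have m0 : m != 0 by rewrite gt_eqF //; lra.
have m10 : m + 1 != 0 by rewrite gt_eqF //; lra.
have sumE : \sum_(r | adjacent p r) harmonic_mean (coeff S m p) (coeff S m r)
    = harmonic_mean (coeff S m p) m *+ nb_neighbours S p
      + harmonic_mean (coeff S m p) 1 *+ nb_neighbours (~: S) p.
  rewrite (bigID [in S]) /=; congr (_ + _).
    rewrite -sumr_const; apply: eq_big => [q|q /andP[_ qS]].
      by rewrite !inE andbC.
    by rewrite /coeff qS.
  rewrite -sumr_const; apply: eq_big => [q|q /andP[_ /negPf qS]].
    by rewrite !inE andbC.
  by rewrite [coeff S m q]/coeff qS.
have hm : harmonic_mean m m = m by rewrite /harmonic_mean; field; rewrite -mulr2n mulrn_eq0.
have h1 : harmonic_mean m 1 = h by rewrite /harmonic_mean mulr1.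
have h1' : harmonic_mean 1 m = h by rewrite /harmonic_mean mulr1 addrC.
have h11 : harmonic_mean 1 1 = 1 :> R by rewrite /harmonic_mean; field.
have := nb_neighboursD S p.
rewrite sumE /coeff; case: ifP adm => pS; rewrite ?hm ?h1 ?h1' ?h11.
  case=> -> ; rewrite mulr0n addr0 addn0.
  move: (nb_neighbours S p) (nb_neighbours (~: S) p) => a [|[|[|//]]] _ ab.
  - have -> : a = 4%N by lia.
    by rewrite mulr0n addr0 mulr_natl.
  - have -> : a = 3%N by lia.
    by rewrite mulr1n mulr_natl.
  - have -> : a = 2%N by lia.
    by rewrite !mulr_natl.
move: (nb_neighbours S p) (nb_neighbours (~: S) p) => a b [->|[-> ->]] /= ab.
  have -> : b = (4 - boundary_edges p)%N by lia.
  rewrite mulr0n add0r mulr1 natrB; last by lia.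
  by rewrite -mulr_natr; ring.
have -> : b = 3%N by lia.
by rewrite mulr1n mulr0n addr0 addrC.
Qed.

Section Spectrum.
Variable R : realType.

Definition diag_scaling n (A : 'M[R]_n) : 'M[R]_n :=
  let D := diag_mx (\row_i (Num.sqrt (A i i))^-1) in D *m A *m D.

(* Real eigenvalues in nondecreasing order, repeated according to their
   algebraic multiplicity; for a symmetric A this is a list of length n. *)
Definition eigenvalues n (A : 'M[R]_n) : seq R :=
  flatten [seq nseq (mup x (char_poly A)) x | x <- rootsR (char_poly A)].

(* The k-th smallest eigenvalue, counting from k = 1. *)
Definition lambda n (A : 'M[R]_n) (k : nat) : R := nth 0 (eigenvalues A) k.-1.

Definition lambda_min n (A : 'M[R]_n) : R := lambda A 1.

Lemma mem_eigenvalues n (A : 'M[R]_n) x :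
  (x \in eigenvalues A) = eigenvalue A x.
Proof.
have p0 : char_poly A != 0 by rewrite monic_neq0 ?char_poly_monic.
have rR y : (y \in rootsR (char_poly A)) = root (char_poly A) y.
  by rewrite -(roots_on_rootsR p0) in_itv.
rewrite eigenvalue_root_char; apply/flatten_mapP/idP => [[y + ]|rx].
  by rewrite mem_nseq rR => ry /andP[_ /eqP->].
exists x; first by rewrite rR.
by rewrite mem_nseq eqxx andbT -XsubC_dvd // dvdp_XsubCl.
Qed.

Lemma count_eigenvalues n (A : 'M[R]_n) x :
  count_mem x (eigenvalues A) = mup x (char_poly A).
Proof.
have p0 : char_poly A != 0 by rewrite monic_neq0 ?char_poly_monic.
have [xA|] := boolP (x \in rootsR (char_poly A)); last first.
  rewrite -(roots_on_rootsR p0) in_itv /= => nrx; rewrite mupNroot //.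
  by apply/count_memPn; rewrite mem_eigenvalues eigenvalue_root_char.
rewrite count_flatten -map_comp.
have -> : [seq (count_mem x \o fun y => nseq (mup y (char_poly A)) y) i
           | i <- rootsR (char_poly A)] =
          [seq ((i == x) * mup x (char_poly A))%N | i <- rootsR (char_poly A)].
  by apply: eq_map => y /=; rewrite count_nseq /=; case: eqP => [->|].
rewrite sumnE big_map -big_distrl /=.
have -> : (\sum_(i <- rootsR (char_poly A)) (i == x) = 1)%N; last by rewrite mul1n.
have := count_uniq_mem x (uniq_roots _ _ _ : uniq (rootsR (char_poly A))).
by rewrite xA -sum1_count big_mkcond /= => <-; apply: eq_bigr => i _; case: eqP.
Qed.

Lemma sorted_eigenvalues n (A : 'M[R]_n) : sorted <=%R (eigenvalues A).
Proof.
rewrite /eigenvalues; have: sorted <%R (rootsR (char_poly A)).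
  exact: sorted_roots.
rewrite (sorted_pairwise lt_trans) (sorted_pairwise le_trans).
elim: (rootsR _) => //= x s IHs /andP[/allP xs /IHs s_sorted].
rewrite pairwise_cat s_sorted andbT; apply/andP; split.
  apply/allrelP => y z; rewrite mem_nseq => /andP[_ /eqP->].
  case/flatten_mapP => t /xs xt; rewrite mem_nseq => /andP[_ /eqP->].
  exact: ltW.
rewrite -(sorted_pairwise le_trans); apply/(sortedP 0) => i.
rewrite size_nseq => lti; rewrite !nth_nseq lti (ltn_trans _ lti) //.
Qed.

End Spectrum.

(* Main.v *)
Require Import Defs.
From HB Require Import structures.
From mathcomp Require Import all_boot all_order all_algebra.
From mathcomp Require Import complex.
From mathcomp Require Import all_classical all_reals all_analysis.
From mathcomp Require Import ring lra zify.

(* With y = D^(-1/2) x, D = diag K(m), the Rayleigh quotient of A(m) at x is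
   E_m(y) / M_m(y), where E_m(y) = y^T K(m) y is a sum of squares over the edges
   of the grid and M_m(y) = y^T D y is a weighted sum of squares over the cells.
   - Since E_1 <= E_m and M_m <= m M_1, the least quotient drops by at most a
     factor m from its value at m = 1.
   - At the indicator function of the island E_m is bounded and M_m >= 2 m, so
     the least eigenvalue is in fact O(1 / m).
   - On the hyperplane of the y that vanish at one fixed island cell p0,
     M_m <= c E_m: on the island by summing m (y_p - y_q)^2 along a path from
     p0, elsewhere by summing (y_p - y_q)^2 along a path from the boundary of the
     square. A lower bound on a hyperplane bounds all eigenvalues but one. *)

Set Implicit Arguments.
Unset Strict Implicit.
Unset Printing Implicit Defensive.

Import Order.TTheory GRing.Theory Num.Theory.
Import numFieldNormedType.Exports.
(* The analysis library has its own [harmonic_mean] and [adjacent]. *)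
Import Defs.

Local Open Scope classical_set_scope.
Local Open Scope ring_scope.

(** * Characteristic polynomials and root multiplicities *)

Lemma char_poly_conj (F : comNzRingType) n (Q D P : 'M[F]_n) :
  Q *m P = 1%:M -> char_poly (Q *m D *m P) = char_poly D.
Proof.
move=> QP; rewrite /char_poly.
have QP' : map_mx polyC Q *m map_mx polyC P = 1%:M.
  by rewrite -map_mxM QP map_mx1.
(* As [X] is scalar and [Q P = 1], the matrix [X - Q D P] factors as [Q (X - D) P]; taking
   determinants then finishes. *)
have -> : char_poly_mx (Q *m D *m P) =
    map_mx polyC Q *m char_poly_mx D *m map_mx polyC P.
  rewrite /char_poly_mx mulmxBr mulmxBl !map_mxM; congr (_ - _).
  by rewrite scalar_mxC -mulmxA QP' mulmx1.
by rewrite !det_mulmx mulrAC -det_mulmx QP' det1 mul1r.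
Qed.

Lemma char_poly_diag (F : comNzRingType) n (d : 'rV[F]_n) :
  char_poly (diag_mx d) = \prod_i ('X - (d 0 i)%:P).
Proof.
rewrite char_poly_trig; last first.
  by apply/is_trig_mxP => i j ij; rewrite mxE (ltn_eqF ij : (i == j) = false).
by apply: eq_bigr => i _; rewrite mxE eqxx.
Qed.

Lemma mup_prod_XsubC (F : fieldType) (s : seq F) x :
  mup x (\prod_(y <- s) ('X - y%:P)) = count_mem x s.
Proof.
elim: s => [|y s IHs]; first by rewrite big_nil mupNroot //= root1.
rewrite big_cons mupM ?polyXsubC_eq0 ?IHs //=; last first.
  by rewrite monic_neq0 // monic_prod_XsubC.
by rewrite -['X - _]expr1 mup_XsubCX; case: (y == x).
Qed.

(** The row with [x_j] at [i] and [- x_i] at [j] kills [x]; if both entries of [x] vanish, a basis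
    row does. This later selects a combination of two eigenvectors lying in a given hyperplane. *)
Lemma two_support_annihilator (F : fieldType) n (x : 'cV[F]_n) (i j : 'I_n) :
  i != j -> exists z : 'rV_n,
    [/\ z *m x = 0, z != 0 & forall l, l != i -> l != j -> z 0 l = 0].
Proof.
move=> ij; pose b := x i 0; pose a := x j 0.
pose z0 : 'rV[F]_n := if (a == 0) && (b == 0) then delta_mx 0 i
  else a *: delta_mx 0 i - b *: delta_mx 0 j.
exists z0.
rewrite /z0; split.
- case: ifP => [/andP[_ /eqP b0]|_].
    by rewrite -rowE; apply/rowP => l; rewrite ord1 mxE [LHS]b0 mxE.
  rewrite mulmxBl -!scalemxAl -!rowE; apply/rowP => l.
  by rewrite ord1 !mxE -[X in _ * X - _]/(b) -[X in _ - _ * X]/(a) mulrC subrr.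
- case: ifP => [_|/negbT]; last rewrite negb_and => /orP ab.
    by apply/eqP => /rowP/(_ i)/eqP; rewrite !mxE !eqxx oner_eq0.
  apply/eqP => z00.
  have zi : (a *: delta_mx 0 i - b *: delta_mx 0 j : 'rV_n) 0 i = a.
    by rewrite !mxE !eqxx (negPf ij) mulr1 mulr0 subr0.
  have zj : (a *: delta_mx 0 i - b *: delta_mx 0 j : 'rV_n) 0 j = - b.
    by rewrite !mxE !eqxx eq_sym (negPf ij) mulr1 mulr0 sub0r.
  move: zi zj; rewrite z00 !mxE => a0 /esym/eqP; rewrite oppr_eq0 => b0.
  by case: ab; rewrite ?b0 // -a0 eqxx.
- move=> l li lj; case: ifP => _; rewrite !mxE ?(negPf li) ?(negPf lj) //=.
  by rewrite !mulr0 subrr.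
Qed.

(** * Spectral theory of real symmetric matrices *)

Section RealSymmetric.
Local Open Scope sesquilinear_scope.
Variables (R : realType) (n : nat).
Local Notation toC := (map_mx (real_complex R)).

(** Over the complex numbers [A] is Hermitian, so the complex spectral theorem applies and its
    diagonal is real; only the eigenbasis [P] stays complex. *)
Lemma symmetric_spectral (A : 'M[R]_n) : A^T = A ->
  exists P : 'M[R[i]%C]_n, exists2 d : 'rV[R]_n,
    P \is unitarymx & toC A = P^t* *m diag_mx (toC d) *m P.
Proof.
move=> Asym.
have Aherm : toC A \is hermsymmx.
  apply: realsym_hermsym.
    apply/is_hermitianmxP; rewrite expr0 scale1r map_mx_id // map_trmx.
    by rewrite Asym.
  apply/mxOverP => i j; rewrite !mxE; by apply/complex_realP; eexists.
have /orthomx_spectralP AE := hermitian_normalmx Aherm.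
have uP := spectral_unitarymx (toC A).
have := hermitian_spectral_diag_real Aherm; move: AE uP.
move: (spectralmx _) (spectral_diag _) => P d AE uP /mxOverP d_real.
have dE : toC (map_mx (fun z => complex.Re z) d) = d.
  by apply/matrixP => i j; rewrite !mxE RRe_real.
exists P; exists (map_mx (fun z => complex.Re z) d); first exact: uP.
by rewrite dE -invmx_unitary.
Qed.

Section Diagonalized.
Variables (A : 'M[R]_n) (P : 'M[R[i]%C]_n) (d : 'rV[R]_n).
Hypothesis unitaryP : P \is unitarymx.
Hypothesis AE : toC A = P^t* *m diag_mx (toC d) *m P.

(** Both lists contain each [x] as often as its multiplicity as a root of [char_poly A], which is
    also the characteristic polynomial of the diagonal matrix. *)
Lemma perm_eigenvalues : perm_eq (eigenvalues A) [seq d 0 i | i <- enum 'I_n].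
Proof.
apply/allP => x _ /=; rewrite count_eigenvalues.
have -> : char_poly A = \prod_(y <- [seq d 0 i | i <- enum 'I_n]) ('X - y%:P).
  apply: (map_poly_inj (real_complex R)).
  rewrite map_char_poly AE char_poly_conj; last first.
    by have /unitarymxP/mulmx1C := unitaryP.
  rewrite char_poly_diag rmorph_prod big_map big_enum /=.
  by apply: eq_bigr => i _; rewrite mxE map_polyXsubC.
by rewrite mup_prod_XsubC.
Qed.

(** [z] holds the coordinates of [w] in the orthonormal basis formed by the rows of [P], in which
    both forms are diagonal. *)
Lemma spectral_form (z : 'rV[R[i]%C]_n) (w := z *m P) :
  (w *m toC A *m w^t*) 0 0 = \sum_i (d 0 i)%:C%C * `|z 0 i| ^+ 2 /\
  (w *m w^t*) 0 0 = \sum_i `|z 0 i| ^+ 2.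
Proof.
have PP : P *m P^t* = 1%:M by apply/unitarymxP.
have wt : w^t* = P^t* *m z^t* by rewrite /w trmx_mul map_mxM.
rewrite wt AE /w; split.
  rewrite !mulmxA -[z *m P *m _]mulmxA PP mulmx1 -[_ *m P *m _]mulmxA PP mulmx1.
  rewrite mxE; apply: eq_bigr => i _.
  by rewrite mul_mx_diag !mxE mulrAC normCK mulrC.
rewrite mulmxA -[z *m P *m _]mulmxA PP mulmx1 mxE; apply: eq_bigr => i _.
by rewrite !mxE normCK.
Qed.

End Diagonalized.

Definition dotr (u v : 'rV[R]_n) : R := (u *m v^T) 0 0.
Definition qform (A : 'M[R]_n) (u : 'rV[R]_n) : R := (u *m A *m u^T) 0 0.

Lemma size_eigenvalues (A : 'M[R]_n) : A^T = A -> size (eigenvalues A) = n.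
Proof.
move=> /symmetric_spectral[P [d uP AE]].
by rewrite (perm_size (perm_eigenvalues uP AE)) size_map size_enum_ord.
Qed.

(** In eigenbasis coordinates the form has the weights [d 0 i], each at least the head of the sorted
    list of eigenvalues. *)
Lemma lambda_min_le (A : 'M[R]_n) (u : 'rV[R]_n) : A^T = A ->
  lambda_min A * dotr u u <= qform A u.
Proof.
move=> /symmetric_spectral[P [d uP AE]].
have PP : P^t* *m P = 1%:M by have /unitarymxP/mulmx1C := uP.
have [] := spectral_form uP AE (toC u *m P^t*).
have -> : toC u *m P^t* *m P = toC u by rewrite -mulmxA PP mulmx1.
have -> : (toC u)^t* = toC u^T.
  by apply/matrixP => i j; rewrite !mxE conj_Creal //; apply/complex_realP; eexists.
rewrite -!map_mxM ![map_mx _ _ 0 0]mxE -/(qform A u) -/(dotr u u) => qE nE.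
rewrite -lecR qE rmorphM /= nE mulr_sumr ler_sum // => i _.
rewrite ler_wpM2r ?exprn_ge0 // lecR.
have : d 0 i \in eigenvalues A.
  by rewrite (perm_mem (perm_eigenvalues uP AE)) map_f // mem_enum.
rewrite /lambda_min /lambda /=; case: (eigenvalues A) (sorted_eigenvalues A) => //= x s.
rewrite (path_sortedE le_trans) => /andP[/allP xs _].
by rewrite inE => /orP[/eqP->|/xs].
Qed.

Lemma lambda_min_attained (A : 'M[R]_n) : A^T = A -> (0 < n)%N ->
  exists2 u, u != 0 & qform A u = lambda_min A * dotr u u.
Proof.
move=> Asym n0.
(* [0 < n] makes the list nonempty, so [nth] does not return its default [0]. *)
have : lambda_min A \in eigenvalues A by rewrite mem_nth ?size_eigenvalues.
rewrite mem_eigenvalues => /eigenvalueP[u uA u0]; exists u => //.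
by rewrite /qform /dotr uA -scalemxAl mxE.
Qed.

(** The cross terms are [i (v A u^T - u A v^T)] and cancel by symmetry. This leads from complex
    combinations of eigenvectors back to real vectors. *)
Lemma complex_form (A : 'M[R]_n) (w : 'rV[R[i]%C]_n) : A^T = A ->
  (w *m toC A *m w^t*) 0 0 =
    (qform A (map_mx (fun z => complex.Re z) w) +
     qform A (map_mx (fun z => complex.Im z) w))%:C%C.
Proof.
set u := map_mx _ w; set v := map_mx _ w => Asym.
have wE : w = toC u + 'i *: toC v.
  by apply/matrixP => i j; rewrite !mxE [LHS]complexE complexiE.
have wtE : w^t* = toC u^T - 'i *: toC v^T.
  apply/matrixP => i j; rewrite !mxE [X in Num.conj X]complexE complexiE.
  rewrite rmorphD rmorphM /= conjCi mulNr.
  by congr (_ - _ * _); apply: conj_Creal; apply/complex_realP; eexists.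
have uv : (u *m A *m v^T) = (v *m A *m u^T).
  (* A 1 x 1 matrix equals its transpose. *)
  rewrite -[RHS]trmxK [v *m A *m u^T]mx11_scalar tr_scalar_mx -mx11_scalar.
  by rewrite !trmx_mul trmxK Asym mulmxA.
rewrite wtE wE !(mulmxDl, mulmxBr, mulmxDr) -!scalemxAl -!scalemxAr -!map_mxM.
rewrite uv scalerA -expr2 sqrCi scaleN1r rmorphD /= /qform !mxE; ring.
Qed.

(* Two eigenvectors with eigenvalues below c span a complex plane, which contains
   some w != 0 with w h = 0; the real and imaginary parts of w also satisfy this
   equation, and the quadratic form splits over them. *)
Lemma le_lambda_hyperplane (A : 'M[R]_n) (h : 'cV[R]_n) (c : R) (k : nat) :
    A^T = A -> (forall u : 'rV_n, u *m h = 0 -> c * dotr u u <= qform A u) ->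
  (2 <= k <= n)%N -> c <= lambda A k.
Proof.
move=> Asym cA /andP[k2 kn]; rewrite leNgt; apply/negP => kc.
have [P [d uP AE]] := symmetric_spectral Asym.
(* [lambda A k] reads position [k.-1], which is past the head when [k >= 2]; by sortedness the two
   smallest eigenvalues are then below [c]. *)
have : (1 < count (fun x => x < c)%R (eigenvalues A))%N.
  have := size_eigenvalues Asym; have := sorted_eigenvalues A.
  move: kc; rewrite /lambda; case: (eigenvalues A) => [|x [|y s]] /=; try lia.
  move=> kc /andP[xy ys] sn.
  have yc : y < c.
    apply: le_lt_trans kc; case: k k2 kn => [|[|k]] //= _ kn.
    have : nth 0 (y :: s) k \in y :: s by rewrite mem_nth //=; lia.
    move: ys; rewrite (path_sortedE le_trans) inE => /andP[/allP ys _].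
    by move=> /orP[/eqP->|/ys].
  by rewrite yc (le_lt_trans xy yc).
rewrite (permP (perm_eigenvalues uP AE)) count_map -size_filter.
have : uniq [seq i <- enum 'I_n | preim (fun i => d 0 i) (fun x => x < c)%R i].
  by rewrite filter_uniq ?enum_uniq.
have := filter_all (preim (fun i => d 0 i) (fun x => x < c)%R) (enum 'I_n).
case: [seq _ <- _ | _] => [|i [|j s]] //= /and3P[ic jc _] /andP[+ _] _.
rewrite inE negb_or => /andP[ij _].
have [z0 [z0h z00 z0l]] := two_support_annihilator (P *m toC h) ij.
pose w := z0 *m P.
have wh : w *m toC h = 0 by rewrite -mulmxA.
have ReD : {morph (fun z : R[i]%C => complex.Re z) : x y / x + y}.
  by case=> [x x'] [y y'].
have ImD : {morph (fun z : R[i]%C => complex.Im z) : x y / x + y}.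
  by case=> [x x'] [y y'].
(* Since [h] is real, taking real parts commutes with the product by [h]. *)
have Reh : map_mx (fun z => complex.Re z) w *m h = 0.
  apply/rowP => l; have /rowP/(_ l) := wh.
  rewrite !mxE => /(congr1 (fun z => complex.Re z)) /= e; apply: etrans e.
  rewrite (big_morph (fun z => complex.Re z) ReD (erefl : complex.Re (0 : R[i]%C) = 0)).
  apply: eq_bigr => r _.
  by rewrite [LHS]mulrC !mxE; case: (\sum_j _) => x y /=;
    rewrite mulr0 subr0 mulrC.
have Imh : map_mx (fun z => complex.Im z) w *m h = 0.
  apply/rowP => l; have /rowP/(_ l) := wh.
  rewrite !mxE => /(congr1 (fun z => complex.Im z)) /= e; apply: etrans e.
  rewrite (big_morph (fun z => complex.Im z) ImD (erefl : complex.Im (0 : R[i]%C) = 0)).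
  apply: eq_bigr => r _.
  by rewrite [LHS]mulrC !mxE; case: (\sum_j _) => x y /=;
    rewrite mulr0 add0r mulrC.
have [qE nE] := spectral_form uP AE z0.
have := complex_form w Asym; rewrite qE => {}qE.
(* At the identity matrix, the same splitting holds for the squared norm of [w]. *)
have := complex_form w (trmx1 _ n : (1%:M)^T = 1%:M).
rewrite map_mx1 mulmx1 nE /qform !mulmx1 => {}nE.
(* This sum is [c |w|^2] minus the form of [A] at [w], hence nonpositive by [cA]. Its terms are
   nonnegative because [z0] is supported on [i] and [j], so all of them vanish. *)
have : \sum_l (c - d 0 l)%:C%C * `|z0 0 l| ^+ 2 <= 0.
  under eq_bigr => l _ do rewrite rmorphB /= mulrBl.
  rewrite sumrB -mulr_sumr qE nE -rmorphM /= subr_le0 lecR mulrDr lerD //; exact: cA.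
have ge0 l : true -> 0 <= (c - d 0 l)%:C%C * `|z0 0 l| ^+ 2.
  move=> _; have [->|li] := eqVneq l i.
    by rewrite mulr_ge0 ?exprn_ge0 // lecR subr_ge0 ltW.
  have [->|lj] := eqVneq l j.
    by rewrite mulr_ge0 ?exprn_ge0 // lecR subr_ge0 ltW.
  by rewrite z0l // normr0 expr0n mulr0.
move=> le0; have : \sum_l (c - d 0 l)%:C%C * `|z0 0 l| ^+ 2 == 0.
  by rewrite eq_le le0 sumr_ge0.
rewrite psumr_eq0 // => /allP z_eq0; case/eqP: z00; apply/rowP => l.
rewrite mxE; have := z_eq0 l; rewrite mem_index_enum => /(_ isT).
rewrite mulf_eq0 sqrf_eq0 normr_eq0 => /orP[|/eqP//].
rewrite (inj_eq (@complexI R) _ 0) subr_eq0 => /eqP cl.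
(* An index with [c = d 0 l] is neither [i] nor [j], so it lies outside the support of [z0]. *)
by apply: z0l; apply: contraTneq isT => le; move: ic jc; rewrite cl le ltxx.
Qed.

End RealSymmetric.

(** * Quadratic forms and diagonal scaling *)

Section Forms.
Variables (R : realType) (n : nat).
Implicit Types (K : 'M[R]_n) (u v : 'rV[R]_n).

Lemma dotrE u v : dotr u v = \sum_i u 0 i * v 0 i.
Proof. by rewrite /dotr mxE; apply: eq_bigr => i _; rewrite mxE. Qed.

Lemma qformE K u : qform K u = \sum_i \sum_j u 0 i * K i j * u 0 j.
Proof.
rewrite /qform mxE exchange_big /=; apply: eq_bigr => j _.
by rewrite !mxE mulr_suml.
Qed.

Lemma dotr_gt0 u : u != 0 -> 0 < dotr u u.
Proof.
move=> u0; rewrite dotrE lt_neqAle sumr_ge0 => [|i _]; last exact: sqr_ge0.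
rewrite andbT eq_sym psumr_eq0 => [|i _]; last exact: sqr_ge0.
apply: contra u0 => /allP ui; apply/eqP/rowP => i; rewrite mxE.
by have := ui i; rewrite mem_index_enum -expr2 sqrf_eq0 => /(_ isT)/eqP.
Qed.

Lemma diag_scaling_sym K : K^T = K -> (diag_scaling K)^T = diag_scaling K.
Proof. by move=> Ks; rewrite /diag_scaling !trmx_mul tr_diag_mx Ks mulmxA. Qed.

Lemma qform_diag_scaling K u :
  qform (diag_scaling K) u = qform K (\row_i (u 0 i * (Num.sqrt (K i i))^-1)).
Proof.
rewrite /qform /diag_scaling; set D := diag_mx _.
have -> : (\row_i (u 0 i * (Num.sqrt (K i i))^-1)) = u *m D.
  by apply/rowP => i; rewrite mul_mx_diag !mxE.
by rewrite trmx_mul tr_diag_mx !mulmxA.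
Qed.

End Forms.

(** * Bounds on the harmonic mean *)

Section HarmonicMean.
Variable R : realType.
Implicit Types a b m : R.

Lemma harmonic_meanC a b : harmonic_mean a b = harmonic_mean b a.
Proof. by rewrite /harmonic_mean addrC [2 * b * a]mulrAC. Qed.

Lemma harmonic_meanxx a : a != 0 -> harmonic_mean a a = a.
Proof. by move=> a0; rewrite /harmonic_mean; field; rewrite -mulr2n mulrn_eq0. Qed.

Lemma harmonic_mean_ge1 a b : 1 <= a -> 1 <= b -> 1 <= harmonic_mean a b.
Proof. by move=> a1 b1; rewrite /harmonic_mean ler_pdivlMr; nra. Qed.

Lemma harmonic_mean_le a b m :
  0 < a <= m -> 0 < b <= m -> harmonic_mean a b <= m.
Proof.
by move=> /andP[a0 am] /andP[b0 bm]; rewrite /harmonic_mean ler_pdivrMr; nra.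
Qed.

Lemma harmonic_mean_le_double a b : 0 < a -> 0 < b -> harmonic_mean a b <= 2 * a.
Proof. by move=> a0 b0; rewrite /harmonic_mean ler_pdivrMr; nra. Qed.

End HarmonicMean.

(** * Energy and mass of a grid function *)

Section Energy.
Variables (R : realType) (N : nat) (S : {set cell N}).
Implicit Types (m : R) (p q : cell N) (y : cell N -> R).

Lemma adjacentC p q : adjacent p q = adjacent q p.
Proof.
rewrite /adjacent /consecutive (eq_sym p.1) (eq_sym p.2).
by rewrite (orbC (p.2.+1 == _)) (orbC (p.1.+1 == _)).
Qed.

Lemma adjacent_irrefl p : adjacent p p = false.
Proof. by rewrite /adjacent /consecutive !eqxx /= !orbb; lia. Qed.

Lemma coeff_ge1 m p : 1 <= m -> 1 <= coeff S m p.
Proof. by move=> m1; rewrite /coeff; case: ifP. Qed.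

Lemma coeff_le m p : 1 <= m -> coeff S m p <= m.
Proof. by move=> m1; rewrite /coeff; case: ifP. Qed.

Lemma coeff1 p : coeff S (1 : R) p = 1.
Proof. by rewrite /coeff if_same. Qed.

(** The division by [2] compensates for each edge occurring as two ordered pairs; the second sum
    comes from the Dirichlet edges. *)
Definition energy m y : R :=
  \sum_p \sum_(q | adjacent p q)
     harmonic_mean (coeff S m p) (coeff S m q) * (y p - y q) ^+ 2 / 2
  + \sum_p (2 * coeff S m p) *+ boundary_edges p * y p ^+ 2.

Definition mass m y : R := \sum_p fv_entry S m p p * y p ^+ 2.

Lemma fv_matrix_sym m : (fv_matrix S m)^T = fv_matrix S m.
Proof.
apply/matrixP => i j; rewrite !mxE /fv_entry.
rewrite eq_sym; case: eqP => [->//|_].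
by rewrite adjacentC harmonic_meanC.
Qed.

(** Summation by parts: averaging the sum over ordered pairs with its copy under the exchange of [p]
    and [q] replaces [y p ^+ 2 - y p * y q] by [(y p - y q) ^+ 2 / 2]. *)
Lemma fv_entry_energy m y :
  \sum_p \sum_q y p * fv_entry S m p q * y q = energy m y.
Proof.
pose t p q := harmonic_mean (coeff S m p) (coeff S m q).
pose T := \sum_p \sum_(q | adjacent p q) t p q * (y p ^+ 2 - y p * y q).
have -> : \sum_p \sum_q y p * fv_entry S m p q * y q =
    T + \sum_p (2 * coeff S m p) *+ boundary_edges p * y p ^+ 2.
  rewrite -big_split /=; apply: eq_bigr => p _.
  rewrite (bigD1 p) //= {1}/fv_entry eqxx.
  have -> : \sum_(q | q != p) y p * fv_entry S m p q * y q =
      - \sum_(q | adjacent p q) t p q * (y p * y q).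
    rewrite -sumrN [RHS]big_mkcond [LHS]big_mkcond /=; apply: eq_bigr => q _.
    rewrite /fv_entry eq_sym; case: eqP => [<-|_]; first by rewrite adjacent_irrefl.
    by case: ifP => _; rewrite /t; ring.
  rewrite (_ : \sum_(q | _) t p q * (_ - _) = (\sum_(q | adjacent p q) t p q) * y p ^+ 2
     - \sum_(q | adjacent p q) t p q * (y p * y q)); last first.
    by rewrite mulr_suml -sumrB; apply: eq_bigr => q _; rewrite mulrBr.
  by rewrite /t; ring.
have TE : T = \sum_p \sum_(q | adjacent p q) t p q * (y q ^+ 2 - y p * y q).
  rewrite /T (exchange_big_dep xpredT) //=; apply: eq_bigr => p _.
  apply: eq_big => [q|q _]; first by rewrite adjacentC.
  by rewrite /t harmonic_meanC [y q * _]mulrC.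
rewrite /energy; congr (_ + _).
have -> : T = (T + T) / 2 by field.
rewrite {2}TE /T -big_split /= mulr_suml; apply: eq_bigr => p _.
by rewrite -big_split /= mulr_suml; apply: eq_bigr => q _; rewrite /t; ring.
Qed.

Lemma sum_enum_val (F : cell N -> R) :
  \sum_(i < #|cell N|) F (enum_val i) = \sum_p F p.
Proof.
rewrite [RHS](reindex (fun i : 'I_#|cell N| => enum_val i)) //=.
exact/onW_bij/enum_val_bij.
Qed.

Lemma qform_fv_matrix m y :
  qform (fv_matrix S m) (\row_i y (enum_val i)) = energy m y.
Proof.
rewrite qformE -fv_entry_energy -sum_enum_val; apply: eq_bigr => i _.
by rewrite -sum_enum_val; apply: eq_bigr => j _; rewrite !mxE.
Qed.

Section LargeCoefficient.
Variables (m : R) (m1 : 1 <= m).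

Lemma conductivity_ge0 p q : 0 <= harmonic_mean (coeff S m p) (coeff S m q).
Proof. by rewrite (le_trans ler01) // harmonic_mean_ge1 ?coeff_ge1. Qed.

Lemma boundary_ge0 p : 0 <= (2 * coeff S m p) *+ boundary_edges p.
Proof. by rewrite mulrn_wge0 // mulr_ge0 // (le_trans ler01) ?coeff_ge1. Qed.

Lemma card_adjacentR p :
  #|[pred q | adjacent p q]|%:R + (boundary_edges p)%:R = 4 :> R.
Proof. by rewrite -natrD -(card_adjacent p) cardsE. Qed.

(** Each of the four edges of [p] contributes at most twice the coefficient at [p] itself, whatever
    lies across it. Diagonal entries outside the island thus stay bounded in [m]. *)
Lemma fv_entry_diag_le p : fv_entry S m p p <= 8 * coeff S m p.
Proof.
rewrite /fv_entry eqxx.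
have c0 : 0 < coeff S m p by rewrite (lt_le_trans ltr01) ?coeff_ge1.
have : \sum_(r | adjacent p r) harmonic_mean (coeff S m p) (coeff S m r) <=
    \sum_(r | adjacent p r) 2 * coeff S m p.
  apply: ler_sum => r _; apply: harmonic_mean_le_double => //.
  by rewrite (lt_le_trans ltr01) ?coeff_ge1.
rewrite sumr_const -mulr_natr -[X in _ + X]mulr_natr.
have := card_adjacentR p => cE; nra.
Qed.

Lemma fv_entry_diag_ge p : 4 <= fv_entry S m p p.
Proof.
rewrite /fv_entry eqxx.
have c1 := coeff_ge1 p m1.
have : \sum_(r | adjacent p r) 1 <=
    \sum_(r | adjacent p r) harmonic_mean (coeff S m p) (coeff S m r).
  by apply: ler_sum => r _; rewrite harmonic_mean_ge1 ?coeff_ge1.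
rewrite sumr_const -[X in _ + X]mulr_natr.
have := card_adjacentR p.
have : 0 <= (boundary_edges p)%:R :> R by [].
nra.
Qed.

Lemma fv_entry_diag_le1 p : fv_entry S m p p <= m * fv_entry S 1 p p.
Proof.
rewrite /fv_entry eqxx mulrDr lerD //.
  rewrite mulr_sumr ler_sum // => r _.
  rewrite !coeff1 harmonic_meanxx ?oner_eq0 // mulr1.
  by rewrite harmonic_mean_le // (lt_le_trans ltr01) ?coeff_ge1 ?coeff_le.
rewrite coeff1 mulr1 mulrnAr lerMn2r; apply/orP; right.
by have := coeff_le p m1; lra.
Qed.

Lemma le_mass y : mass m y <= m * mass 1 y.
Proof.
rewrite /mass mulr_sumr ler_sum // => p _.
by rewrite mulrA ler_wpM2r ?sqr_ge0 // fv_entry_diag_le1.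
Qed.

Lemma le_energy y : energy 1 y <= energy m y.
Proof.
rewrite /energy lerD // ler_sum // => p _.
  apply: ler_sum => q _; rewrite ler_wpM2r ?invr_ge0 // ler_wpM2r ?sqr_ge0 //.
  by rewrite !coeff1 harmonic_meanxx ?oner_eq0 // harmonic_mean_ge1 ?coeff_ge1.
by rewrite ler_wpM2r ?sqr_ge0 // lerMn2r coeff1 ler_wpM2l ?coeff_ge1 ?orbT.
Qed.

Lemma energy_edge_ge0 y p q :
  0 <= harmonic_mean (coeff S m p) (coeff S m q) * (y p - y q) ^+ 2 / 2.
Proof. by rewrite divr_ge0 // mulr_ge0 ?sqr_ge0 ?conductivity_ge0. Qed.

Lemma energy_boundary_ge0 y p :
  0 <= (2 * coeff S m p) *+ boundary_edges p * y p ^+ 2.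
Proof. by rewrite mulr_ge0 ?sqr_ge0 ?boundary_ge0. Qed.

Lemma energy_ge0 y : 0 <= energy m y.
Proof.
rewrite addr_ge0 ?sumr_ge0 // => p _; last exact: energy_boundary_ge0.
by rewrite sumr_ge0 // => q _; exact: energy_edge_ge0.
Qed.

(** The factor [2] arises because only the ordered pair [(p, q)] is kept. *)
Lemma energy_ge_edge y p q : adjacent p q ->
  harmonic_mean (coeff S m p) (coeff S m q) * (y p - y q) ^+ 2 <= 2 * energy m y.
Proof.
move=> pq; rewrite -ler_pdivrMl // mulrC /energy (bigD1 p) //= (bigD1 q) //=.
rewrite -!addrA lerDl !addr_ge0 ?sumr_ge0 // => r _.
- exact: energy_edge_ge0.
- by rewrite sumr_ge0 // => s _; exact: energy_edge_ge0.
- exact: energy_boundary_ge0.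
Qed.

Lemma energy_ge_boundary y p : (0 < boundary_edges p)%N ->
  y p ^+ 2 <= energy m y.
Proof.
move=> bp; rewrite /energy [X in _ + X](bigD1 p) //=.
apply: (@le_trans _ _ ((2 * coeff S m p) *+ boundary_edges p * y p ^+ 2)).
  rewrite ler_peMl ?sqr_ge0 // -(prednK bp) mulrSr.
  have := coeff_ge1 p m1.
  have : 0 <= (2 * coeff S m p) *+ (boundary_edges p).-1.
    by rewrite mulrn_wge0 // mulr_ge0 // (le_trans ler01) ?coeff_ge1.
  lra.
rewrite addrCA lerDl addr_ge0 ?sumr_ge0 // => r _.
  by rewrite sumr_ge0 // => s _; exact: energy_edge_ge0.
exact: energy_boundary_ge0.
Qed.

Lemma mass_le y : mass m y <= 8 * \sum_p coeff S m p * y p ^+ 2.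
Proof.
rewrite mulr_sumr ler_sum // => p _.
by rewrite mulrA ler_wpM2r ?sqr_ge0 // fv_entry_diag_le.
Qed.

End LargeCoefficient.

End Energy.

(** * Coercivity of the energy on functions vanishing at an island cell *)

Section Coercivity.
Variables (R : realType) (N : nat) (S : {set cell N}).
Implicit Types (m : R) (p q : cell N) (y : cell N -> R).

(** One step of a path, from [y_q^2 <= 2 y_p^2 + 2 (y_p - y_q)^2]; the edge energy turns the last
    term into the summand [4]. *)
Lemma energy_step m w c y p q : 1 <= m -> 0 <= w -> adjacent p q ->
  w <= harmonic_mean (coeff S m p) (coeff S m q) ->
  w * y p ^+ 2 <= c * energy S m y ->
  w * y q ^+ 2 <= (2 * c + 4) * energy S m y.
Proof.
move=> m1 w0 pq wt yp; have := energy_ge_edge S m1 y pq.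
have : w * (y p - y q) ^+ 2 <=
    harmonic_mean (coeff S m p) (coeff S m q) * (y p - y q) ^+ 2.
  by rewrite ler_wpM2r ?sqr_ge0.
(* The square is exactly [2 y_p^2 + 2 (y_p - y_q)^2 - y_q^2]. *)
have : 0 <= w * (2 * y p - y q) ^+ 2 by rewrite mulr_ge0 ?sqr_ge0.
nra.
Qed.

(** Between island cells the conductivity is exactly [m], so the weight [m] survives every step of a
    path inside the island; [c] depends on the path but not on [m] or [y]. *)
Lemma island_control p0 p : edge_connected S -> p0 \in S -> p \in S ->
  exists2 c : R, 0 <= c & forall m y, 1 <= m -> y p0 = 0 ->
    m * y p ^+ 2 <= c * energy S m y.
Proof.
move=> Sconn p0S pS.
pose controlled q :=
  exists2 c : R, 0 <= c & forall m y, 1 <= m -> y p0 = 0 ->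
    m * y q ^+ 2 <= c * energy S m y.
have p0_controlled : controlled p0.
  by exists 0 => // m y _ ->; rewrite expr0n mulr0 mul0r.
have /connectP[s + ->] := Sconn _ _ p0S pS; rewrite -/(controlled _).
(* The starting cell of the path is generalized, while the condition [y p0 = 0] inside [controlled]
   stays at the original cell. *)
elim: s {1 2 3}p0 p0_controlled => //= q s IHs r [c c0 rc].
case/andP => /and3P[rS qS rq] path_s.
apply: IHs path_s; exists (2 * c + 4); first by rewrite addr_ge0 ?mulr_ge0.
move=> m y m1 y0; apply: (energy_step m1 _ rq) (rc _ _ m1 y0).
  by rewrite (le_trans ler01).
by rewrite /coeff rS qS harmonic_meanxx // gt_eqF // (lt_le_trans ltr01).
Qed.

(** Cells with first coordinate [0] have a boundary edge; the others are reached by increasing that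
    coordinate across edges of conductivity at least [1]. *)
Lemma grid_control p :
  exists2 c : R, 0 <= c & forall m y, 1 <= m -> y p ^+ 2 <= c * energy S m y.
Proof.
case: p => [[i iN] j]; elim: i iN => [|i IHi] iN.
  exists 1 => // m y m1; rewrite mul1r; exact: energy_ge_boundary.
have [c c0 yc] := IHi (ltnW iN); exists (2 * c + 4).
  by rewrite addr_ge0 ?mulr_ge0.
move=> m y m1; have := yc m y m1; rewrite -[X in X <= _ -> _]mul1r.
rewrite -[X in _ -> X <= _]mul1r; apply: energy_step => //.
  by rewrite /adjacent /consecutive /= !eqxx orbT.
by rewrite harmonic_mean_ge1 ?coeff_ge1.
Qed.

Lemma energy_coercive p0 : edge_connected S -> p0 \in S ->
  exists2 C : R, 0 < C & forall m y, 1 <= m -> y p0 = 0 ->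
    C * mass S m y <= energy S m y.
Proof.
move=> Sconn p0S.
have /choice[c cP] p : exists c : R, 0 <= c /\ forall m y, 1 <= m -> y p0 = 0 ->
    coeff S m p * y p ^+ 2 <= c * energy S m y.
  have [pS|pS] := boolP (p \in S).
    have [c c0 yc] := island_control Sconn p0S pS; exists c; split=> // m y m1 y0.
    by rewrite /coeff pS; exact: yc.
  have [c c0 yc] := grid_control p; exists c; split=> // m y m1 y0.
  by rewrite /coeff (negPf pS) mul1r; exact: yc.
(* The [8] comes from [mass_le]; the [+ 1] keeps [C] positive even if every [c p] is zero. *)
pose C := 8 * (\sum_p c p) + 1.
have C0 : 0 < C.
  by rewrite ltr_wpDl // mulr_ge0 // sumr_ge0 // => p _; case: (cP p).
exists C^-1; first by rewrite invr_gt0.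
move=> m y m1 y0; rewrite mulrC ler_pdivrMr //.
have E0 := energy_ge0 S m1 y.
have := mass_le S m1 y.
have : \sum_p coeff S m p * y p ^+ 2 <= \sum_p c p * energy S m y.
  by apply: ler_sum => p _; case: (cP p) => _; exact.
rewrite -mulr_suml /C; nra.
Qed.

End Coercivity.

(** * Rayleigh quotients of the scaled matrix and eigenvalue bounds *)

Section ScaledMatrix.
Variables (R : realType) (N : nat) (S : {set cell N}) (m : R).
Hypothesis m1 : 1 <= m.
Local Notation A := (diag_scaling (fv_matrix S m)).
Local Notation sq p := (Num.sqrt (fv_entry S m p p)).

Lemma scaled_sym : A^T = A.
Proof. by rewrite diag_scaling_sym // fv_matrix_sym. Qed.

Definition unscale (u : 'rV[R]_#|cell N|) (p : cell N) : R :=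
  u 0 (enum_rank p) / sq p.

Definition scale (y : cell N -> R) : 'rV[R]_#|cell N| :=
  \row_i (y (enum_val i) * sq (enum_val i)).

Lemma sqrt_diag_gt0 p : 0 < sq p.
Proof. by rewrite sqrtr_gt0 (lt_le_trans _ (fv_entry_diag_ge S m1 p)). Qed.

Lemma scaleK : cancel scale unscale.
Proof.
move=> y; apply/funext => p; rewrite /unscale mxE enum_rankK mulfK //.
by rewrite gt_eqF ?sqrt_diag_gt0.
Qed.

Lemma qform_scaled u : qform A u = energy S m (unscale u).
Proof.
rewrite qform_diag_scaling -qform_fv_matrix; congr qform.
by apply/rowP => i; rewrite !mxE /unscale enum_valK.
Qed.

Lemma dotr_scaled u : dotr u u = mass S m (unscale u).
Proof.
rewrite dotrE /mass -sum_enum_val; apply: eq_bigr => i _.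
rewrite /unscale enum_valK expr_div_n sqr_sqrtr.
  by rewrite mulrCA divff ?mulr1 // gt_eqF // (lt_le_trans _ (fv_entry_diag_ge S m1 _)).
by rewrite (le_trans _ (fv_entry_diag_ge S m1 _)).
Qed.

Lemma lambda_min_mass y : lambda_min A * mass S m y <= energy S m y.
Proof.
by have := lambda_min_le (scale y) scaled_sym;
  rewrite qform_scaled dotr_scaled scaleK.
Qed.

Lemma lambda_min_minimizer : S != finset.set0 ->
  exists2 y, 0 < mass S m y & energy S m y = lambda_min A * mass S m y.
Proof.
case/set0Pn => p _; have [|u u0 uE] := lambda_min_attained scaled_sym.
  by apply/card_gt0P; exists p.
exists (unscale u); first by rewrite -dotr_scaled dotr_gt0.
by rewrite -qform_scaled -dotr_scaled.
Qed.

Lemma lambda_min_ge0 : S != finset.set0 -> 0 <= lambda_min A.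
Proof.
case/lambda_min_minimizer => y y0 yE.
by rewrite -(pmulr_lge0 _ y0) -yE energy_ge0.
Qed.

Lemma lambda_min_upper : S != finset.set0 -> admissible_types S ->
  lambda_min A <= (#|cell N| ^ 2)%:R / m.
Proof.
case/set0Pn => p0 p0S adm; pose y p : R := (p \in S)%:R.
have m0 : 0 < m by rewrite (lt_le_trans ltr01).
(* A single island cell suffices: each of its three possible diagonal entries is at least
   [2 * m]. *)
have massE : 2 * m <= mass S m y.
  have yp0 : y p0 = 1 by rewrite /y p0S.
  rewrite /mass (bigD1 p0) //= yp0 expr1n mulr1.
  have : 0 <= \sum_(p | p != p0) fv_entry S m p p * y p ^+ 2.
    rewrite sumr_ge0 // => p _; rewrite mulr_ge0 ?sqr_ge0 //.
    by rewrite (le_trans _ (fv_entry_diag_ge S m1 p)).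
  have : 0 <= 2 * m / (m + 1) by rewrite divr_ge0 ?mulr_ge0 ?addr_ge0 // ltW.
  rewrite fv_entry_diag // p0S; set h := 2 * m / (m + 1).
  by case: (nb_neighbours _ _) => [|[|?]]; lra.
have energyE : energy S m y <= (#|cell N| ^ 2)%:R.
  (* Island cells have no boundary edge, so the Dirichlet terms vanish at the indicator function. *)
  rewrite /energy [X in _ + X]big1 ?addr0; last first.
    move=> p _; rewrite /y; have := adm p; case: (p \in S) => [[-> _]|_].
      by rewrite mulr0n mul0r.
    by rewrite expr0n mulr0.
  have -> : (#|cell N| ^ 2)%:R = \sum_(p : cell N) \sum_(q : cell N) 1 :> R.
    by rewrite !sumr_const -mulrnA mulnn.
  apply: ler_sum => p _; rewrite big_mkcond; apply: ler_sum => q _ /=.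
  (* Only pairs across the interface contribute. Their conductivity is at most [2] for every [m], so
     each ordered pair costs at most [1]. *)
  case: ifP => // _; rewrite /y /coeff.
  have h2 : harmonic_mean 1 m <= 2 :> R.
    by rewrite -[leRHS]mulr1 harmonic_mean_le_double.
  have half : harmonic_mean 1 m / 2 <= 1 :> R by rewrite ler_pdivrMr // mul1r.
  case: (p \in S); case: (q \in S);
    rewrite ?subrr ?expr0n ?mulr0 ?mul0r //= ?subr0 ?sub0r ?sqrrN ?expr1n mulr1 //.
  by rewrite harmonic_meanC.
have l0 : 0 <= lambda_min A by apply: lambda_min_ge0; apply/set0Pn; exists p0.
rewrite ler_pdivlMr //; apply: le_trans energyE.
apply: le_trans (lambda_min_mass y); rewrite ler_wpM2l //.
by apply: le_trans massE; rewrite ler_peMl ?ler1n // ltW.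
Qed.

End ScaledMatrix.

(** With [l] the least eigenvalue at coefficient [1], the minimizer for [m] satisfies
    [l M_m <= m l M_1 <= m E_1 <= m E_m]; the first inequality uses [0 <= l]. *)
Lemma lambda_min_lower (R : realType) (N : nat) (S : {set cell N}) (m : R) :
  1 <= m -> S != finset.set0 ->
  lambda_min (diag_scaling (fv_matrix S 1)) * m^-1
    <= lambda_min (diag_scaling (fv_matrix S m)).
Proof.
move=> m1 S0; have m0 : 0 < m by rewrite (lt_le_trans ltr01).
have [y y0 yE] := lambda_min_minimizer m1 S0.
have quotient (a b c e : R) : 0 < c -> e = b * c -> a * c <= e * m -> a * m^-1 <= b.
  by move=> c0 ->; rewrite mulrAC ler_pM2r // ler_pdivrMr.
apply: (quotient _ _ _ _ y0 yE).
have l0 := lambda_min_ge0 (lexx 1 : 1 <= 1 :> R) S0.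
apply: le_trans (ler_wpM2l l0 (le_mass S m1 y)) _.
rewrite mulrCA mulrC ler_pM2r //; apply: le_trans (le_energy S m1 y).
exact: (lambda_min_mass S (lexx 1)).
Qed.

Lemma lambda2_lower (R : realType) (N : nat) (S : {set cell N}) :
  S != finset.set0 -> edge_connected S ->
  exists2 C : R, 0 < C & forall m k, 1 <= m -> (2 <= k <= N ^ 2)%N ->
    C <= lambda (diag_scaling (fv_matrix S m)) k.
Proof.
case/set0Pn => p0 p0S Sconn.
have [C C0 CP] := @energy_coercive R N S p0 Sconn p0S.
exists C => // m k m1 kN.
(* The hyperplane is the vanishing of the coordinate of [p0], which amounts to [y p0 = 0] after
   unscaling. *)
apply: (@le_lambda_hyperplane _ _ _ (delta_mx (enum_rank p0) 0)).
- exact: scaled_sym.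
- move=> u; rewrite -colE => /colP/(_ 0); rewrite !mxE => u0.
  rewrite qform_scaled // (dotr_scaled S m1); apply: CP => //.
  by rewrite /unscale u0 mul0r.
- by rewrite card_prod card_ord mulnn.
Qed.

Theorem mainTheorem4 (R : realType) (N : nat) (Omega1 : {set cell N})
    (island_Omega1 : is_island Omega1) :
  let A := fun m : R => diag_scaling (fv_matrix Omega1 m) in
  [/\ exists C2 : R, \forall m \near +oo,
        lambda_min (A 1) * m^-1 <= lambda_min (A m) <= C2 * (Num.sqrt m)^-1,
      exists2 C : R, 0 < C &
        \forall m \near +oo, forall k : nat, (2 <= k <= N ^ 2)%N ->
          C <= lambda (A m) k
    & lambda_min (A m) @[m --> +oo] --> (0 : R)].
Proof.
case: island_Omega1 => S0 Sconn adm A.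
have near1 : \forall m \near (+oo : set_system R), 1 <= m.
  exact: nbhs_pinfty_ge.
split.
- exists (#|cell N| ^ 2)%:R; near=> m.
  have m1 : 1 <= m by near: m.
  rewrite lambda_min_lower //=; apply: le_trans (lambda_min_upper m1 S0 adm) _.
  (* The bound of order [1 / m] implies the required one, as [sqrt m <= m] for [m >= 1]. *)
  rewrite ler_wpM2l // lef_pV2 ?posrE ?sqrtr_gt0 ?(lt_le_trans ltr01) //.
  rewrite -[leRHS]ger0_norm ?(le_trans ler01) // -sqrtr_sqr ler_wsqrtr //.
  by rewrite expr2 ler_peMl // (le_trans ler01).
- have [C C0 CP] := @lambda2_lower R N Omega1 S0 Sconn.
  by exists C => //; near=> m => k; apply: CP; near: m.
- have inv0 : (#|cell N| ^ 2)%:R / m @[m --> +oo] --> (0 : R).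
    rewrite -[X in _ --> X](mulr0 (#|cell N| ^ 2)%:R).
    apply: cvgM; first exact: cvg_cst.
    apply/(@gtr0_cvgV0 _ _ _ _ id); last exact: cvg_id.
    exact: nbhs_pinfty_gt.
  apply: (squeeze_cvgr _ (cvg_cst 0) inv0); near=> m.
  have m1 : 1 <= m by near: m.
  by rewrite lambda_min_ge0 // lambda_min_upper.
Unshelve. all: by end_near.
Qed.
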